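(* Let $K$ be a field, let $J$ be the ideal generated by all adjacent $2$-minors of an $m\times n$ matrix $X=(x_{ij})$ of indeterminates over $K$, and let $k$ and $l$ be integers such that $m=4k+p$ and $n=4l+q$ with $0\leq p,q<4$. Then $$\operatorname{nilpot}(J)\geq\left(k+\left\lfloor\frac{p}{3}\right\rfloor\right)\left(l+\left\lfloor\frac{q}{3}\right\rfloor\right)+1.$$ In particular, the index of nilpotency of the binomial edge ideal of a pair of graphs can be arbitrarily big.
   Context: The adjacent $2$-minors of $X$ are the polynomials $x_{i,j}x_{i+1,j+1}-x_{i,j+1}x_{i+1,j}$ with $1\le i\le m-1$, $1\le j\le n-1$, in the polynomial ring $K[X]$. For an ideal $I$ in a Noetherian ring, the index of nilpotency $\operatorname{nilpot}(I)$ is the minimal integer $k$ such that $(\sqrt{I})^k\subset I$. For finite simple graphs $G_1$ on $[m]=\{1,\ldots,m\}$ and $G_2$ on $[n]$, the binomial edge ideal of the pair $(G_1,G_2)$ is the ideal of $K[X]$ generated by all $x_{ik}x_{jl}-x_{il}x_{jk}$ with $i<j$, $k<l$, $\{i,j\}\in E(G_1)$, $\{k,l\}\in E(G_2)$. When $G_1$ and $G_2$ are the paths $1,2,\ldots,m$ and $1,2,\ldots,n$, this is the ideal of adjacent $2$-minors of $X$. *)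

(* Defs.v *)
From HB Require Import structures.
From mathcomp Require Import all_boot all_order all_algebra.
From mathcomp Require Import mpoly.
From Stdlib Require Import ClassicalEpsilon.

Set Implicit Arguments.
Unset Strict Implicit.
Unset Printing Implicit Defensive.

Import GRing.Theory.
Local Open Scope ring_scope.

(* Ideals are Prop-valued predicates: the ideals of ring_quotient.v are boolean
   predicates and are required to be proper, so they include neither the unit
   ideal nor, without a membership test, the ideal generated by a set. *)
Section Ideals.

Variable R : comNzRingType.
Implicit Types (S I J : R -> Prop) (f : R).

Definition ideal_gen S f : Prop :=
  exists (r : nat) (a s : 'I_r -> R),
    (forall t, S (s t)) /\ f = \sum_(t < r) a t * s t.

Definition ideal_mul I J : R -> Prop :=
  ideal_gen (fun f => exists g h, [/\ I g, J h & f = g * h]).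

Fixpoint ideal_exp I (k : nat) : R -> Prop :=
  if k is k'.+1 then ideal_mul I (ideal_exp I k') else fun=> True.

Definition radical I f : Prop := exists2 k : nat, (0 < k)%N & I (f ^+ k).

Definition is_nilpotency_index I (k : nat) : Prop :=
  (forall f, ideal_exp (radical I) k f -> I f) /\
  (forall j, (forall f, ideal_exp (radical I) j f -> I f) -> (k <= j)%N).

(* When R is Noetherian and I is an ideal, the index exists, and it is always
   unique, so the choice is then determined.  Otherwise the value is an
   unspecified natural number. *)
Definition nilpot I : nat := epsilon (inhabits 0%N) (is_nilpotency_index I).

End Ideals.

Section Minors.

Variables (K : fieldType) (m n : nat).

(* K[X] has m * n variables; mxvec_index is the bijection of 'I_m * 'I_n with
   'I_(m * n).  Rows and columns are numbered from 0. *)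
Definition genericX : 'M[{mpoly K[m * n]}]_(m, n) :=
  \matrix_(i, j) 'X_(mxvec_index i j).

Definition minor2 (i j : 'I_m) (k l : 'I_n) : {mpoly K[m * n]} :=
  genericX i k * genericX j l - genericX i l * genericX j k.

Definition adjacent_minors_ideal : {mpoly K[m * n]} -> Prop :=
  ideal_gen (fun f => exists (i i' : 'I_m) (j j' : 'I_n),
    [/\ i' = i.+1 :> nat, j' = j.+1 :> nat & f = minor2 i i' j j']).

Definition binomial_edge_ideal (E1 : rel 'I_m) (E2 : rel 'I_n) :
    {mpoly K[m * n]} -> Prop :=
  ideal_gen (fun f => exists (i j : 'I_m) (k l : 'I_n),
    [/\ (i < j)%N, (k < l)%N, E1 i j, E2 k l & f = minor2 i j k l]).

End Minors.

Definition simple_graph (V : finType) (E : rel V) : Prop :=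
  ssrbool.symmetric E /\ irreflexive E.

(* Main.v *)
(* For a 3 x 3 matrix with rows (a b c), (d e f), (g h i), the binomial
   e (a i - c g) is not in the ideal J of adjacent minors, but its square is,
   since e^2 a i and e^2 c g are both congruent to b d f h.  Membership in a
   binomial ideal is decided by moves on monomials: the component of a e i is
   {a e i, b d i, a f h}, i.e. the permutation matrices of exponents vanishing at
   the corners c and g, and it does not contain c e g.  An m x n matrix contains
   (k + [p/3]) (l + [q/3]) disjoint 3 x 3 blocks separated by single rows and
   columns.  The sum of the coefficients of the monomials that restrict to this
   component on each block and involve no other variable is a linear functional
   that kills J and takes the value 1 on the product of the binomials of the
   blocks.  So that product of elements of the radical, and any subproduct, is
   not in J.

   A lower bound on nilpot also needs the index to exist, hence the radical to be
   finitely generated: Dickson's lemma and division by leading monomials give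
   Hilbert's basis theorem. *)
Require Import Defs.
From mathcomp Require Import all_boot all_order all_algebra.
From mathcomp Require Import mpoly ring zify.
From Stdlib Require Import ClassicalEpsilon FunctionalExtensionality.
From Stdlib Require Import PropExtensionality.

Set Implicit Arguments.
Unset Strict Implicit.
Unset Printing Implicit Defensive.

Import Order.TTheory GRing.Theory.
Local Open Scope ring_scope.

(** * The index of nilpotency exists *)

Definition is_ideal (R : comNzRingType) (I : R -> Prop) : Prop :=
  [/\ I 0, forall f g, I f -> I g -> I (f + g) & forall a f, I f -> I (a * f)].

Lemma ideal_gen_ideal (R : comNzRingType) (S : R -> Prop) :
  is_ideal (ideal_gen S).
Proof.
split.
- exists 0%N, (fun=> 0), (fun=> 0); split; first by case.
  by rewrite big_ord0.
- move=> _ _ [r [a [s [Ss ->]]]] [r' [a' [s' [Ss' ->]]]].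
  exists (r + r')%N,
    (fun t => match split t with inl u => a u | inr v => a' v end),
    (fun t => match split t with inl u => s u | inr v => s' v end).
  split; first by move=> t; case: (split t).
  rewrite big_split_ord /=; congr (_ + _); apply: eq_bigr => t _.
    by rewrite (unsplitK (inl t)).
  by rewrite (unsplitK (inr t)).
- move=> b _ [r [a [s [Ss ->]]]]; exists r, (fun t => b * a t), s.
  by split=> //; rewrite mulr_sumr; apply: eq_bigr => t _; rewrite mulrA.
Qed.

Lemma ideal_gen_mem (R : comNzRingType) (S : R -> Prop) f :
  S f -> ideal_gen S f.
Proof.
move=> Sf; exists 1%N, (fun=> 1), (fun=> f).
by split=> //; rewrite big_ord1 mul1r.
Qed.

Lemma ideal_sum (R : comNzRingType) (I : R -> Prop) (T : Type) (r : seq T)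
    (F : T -> R) :
  is_ideal I -> (forall t, I (F t)) -> I (\sum_(t <- r) F t).
Proof. by case=> I0 ID _ IF; elim/big_ind: _ => // f g; apply: ID. Qed.

Lemma ideal_gen_sub (R : comNzRingType) (S I : R -> Prop) :
  is_ideal I -> (forall f, S f -> I f) -> forall f, ideal_gen S f -> I f.
Proof.
move=> Iid SI _ [r [a [s [Ss ->]]]]; apply: ideal_sum => // t.
by case: Iid => _ _; apply; apply: SI.
Qed.

Lemma mem_radical (R : comNzRingType) (I : R -> Prop) f : I f -> radical I f.
Proof. by exists 1%N. Qed.

Lemma radical_ideal (R : comNzRingType) (I : R -> Prop) :
  is_ideal I -> is_ideal (radical I).
Proof.
move=> Iid; have [I0 ID IM] := Iid; split; first exact: mem_radical.
- move=> f g [k k_gt0 Ifk] [l l_gt0 Igl].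
  exists (k + l)%N; first by rewrite addn_gt0 k_gt0.
  rewrite exprDn; apply: ideal_sum => // i; rewrite -mulr_natl.
  case: (leqP l i) => li.
    by rewrite -(subnK li) exprD !mulrA; apply: IM.
  have ki : (k <= k + l - i)%N by lia.
  by rewrite -(subnK ki) exprD -mulrA [f ^+ k * _]mulrC !mulrA; apply: IM.
- move=> a f [k k_gt0 Ifk]; exists k => //.
  by rewrite exprMn; apply: IM.
Qed.

Lemma ideal_exp_sub (R : comNzRingType) (I : R -> Prop) k f :
    ideal_exp I k f -> forall Q : R -> Prop, is_ideal Q ->
    (forall h : seq R, size h = k -> (forall x, x \in h -> I x) ->
       Q (\prod_(x <- h) x)) ->
  Q f.
Proof.
elim: k f => [|k IHk] f.
  move=> _ Q [_ _ QM] Qh; rewrite -[f]mulr1; apply: QM.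
  by have := Qh [::] erefl; rewrite big_nil; apply.
move=> Ikf Q Qid Qh; apply: ideal_gen_sub Ikf => // _ [g [h [Ig Ih ->]]].
have [Q0 QD QM] := Qid.
(* The induction hypothesis is used for the colon ideal of [Q] by [g]. *)
apply: (IHk h Ih (fun x => Q (g * x))).
  split=> [|x y Qx Qy|a x Qx]; first by rewrite mulr0.
    by rewrite mulrDr; apply: QD.
  by rewrite mulrCA; apply: QM.
move=> s sk Is; have := Qh (g :: s); rewrite big_cons /= sk; apply=> // x.
by rewrite inE => /predU1P[->|/Is].
Qed.

(** The ideal generated by a finite list, in recursive form so that inductions split off one
    generator at a time. *)
Fixpoint spanned (R : comNzRingType) (gs : seq R) (f : R) : Prop :=
  if gs is g :: gs' then exists a b, spanned gs' b /\ f = a * g + b else f = 0.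

Lemma spanned_ideal (R : comNzRingType) (gs : seq R) : is_ideal (spanned gs).
Proof.
elim: gs => [|g gs [I0 ID IM]] /=.
  by split=> // [f h -> ->|a f ->]; rewrite ?addr0 ?mulr0.
split.
- by exists 0, 0; rewrite mul0r addr0.
- move=> _ _ [a [b [Ib ->]]] [a' [b' [Ib' ->]]].
  by exists (a + a'), (b + b'); split; [apply: ID | ring].
- move=> c _ [a [b [Ib ->]]].
  by exists (c * a), (c * b); split; [apply: IM | ring].
Qed.

Lemma spanned_mem (R : comNzRingType) (gs : seq R) g :
  g \in gs -> spanned gs g.
Proof.
elim: gs => //= h gs IHgs; rewrite inE => /predU1P[<-|/IHgs Sg].
  by exists 1, 0; split; [case: (spanned_ideal gs) | ring].
by exists 0, g; split=> //; ring.
Qed.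

Lemma spanned_nilpotent (R : comNzRingType) (J : R -> Prop) (gs : seq R) :
    is_ideal J -> (forall g, g \in gs -> radical J g) ->
  exists N, forall h : seq R, (N <= size h)%N ->
    (forall x, x \in h -> spanned gs x) -> J (\prod_(x <- h) x).
Proof.
move=> [J0 JD JM]; elim: gs => [|g gs IHgs] nil_gs.
  (* The bound is 1 rather than 0 because the empty product is 1. *)
  exists 1%N => -[|x h] //= _ /(_ x (mem_head _ _)) ->.
  by rewrite big_cons mul0r.
have [|N0 prodJ] := IHgs; first by move=> x gsx; apply: nil_gs; rewrite inE gsx orbT.
have [k _ Jgk] := nil_gs g (mem_head _ _).
(* Each f in F is a g + b: expanding f adds a factor g or an element to B, so
   one of the two reaches its bound k or N0 before F is exhausted. *)
suff main (F B : seq R) (i : nat) :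
    (forall x, x \in F -> spanned (g :: gs) x) ->
    (forall x, x \in B -> spanned gs x) ->
    (k + N0 <= i + size B + size F)%N ->
    J (g ^+ i * \prod_(x <- B) x * \prod_(x <- F) x).
  exists (k + N0)%N => h szh hS.
  by have := main h [::] 0%N hS; rewrite big_nil expr0 !mul1r; apply.
elim: F B i => [|f F IHF] B i FS BS szFB.
  rewrite big_nil mulr1.
  have [ki|ik] := leqP k i.
    by rewrite mulrC -(subnK ki) exprD mulrA; apply: JM.
  by apply/JM/prodJ => //=; rewrite /= in szFB; lia.
have [a [b [Sb ->]]] := FS f (mem_head _ _).
have FS' x : x \in F -> spanned (g :: gs) x.
  by move=> xF; apply: FS; rewrite inE xF orbT.
rewrite big_cons.
set PB := \prod_(x <- B) x; set PF := \prod_(x <- F) x.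
have -> : g ^+ i * PB * ((a * g + b) * PF) =
    a * (g ^+ i.+1 * PB * PF) + g ^+ i * \prod_(x <- b :: B) x * PF.
  by rewrite big_cons -/PB exprS; ring.
apply: JD.
  by apply/JM/IHF => //=; rewrite /= in szFB; lia.
apply: IHF => //=; last by rewrite /= in szFB; lia.
by move=> x; rewrite inE => /predU1P[->|/BS].
Qed.

Lemma dickson_seq n (P : seq nat -> Prop) :
    (forall s, P s -> size s = n) ->
  exists B : seq (seq nat), (forall b, b \in B -> P b) /\
    forall s, P s -> exists2 b, b \in B & forall i, (nth 0 b i <= nth 0 s i)%N.
Proof.
elim: n P => [|n IHn] P szP.
  case: (classic (P [::])) => Pnil.
    exists [:: [::]]; split=> [b|s /szP/size0nil->]; first by rewrite inE => /eqP->.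
    by exists [::].
  by exists [::]; split=> // s Ps; case: Pnil; rewrite -(size0nil (szP _ Ps)).
have [|B' [B'P B'min]] := IHn (fun t => exists a, P (a :: t)).
  by move=> t [a /szP[]].
have [L [A [LP LA]]] : exists (L : seq (seq nat)) (A : nat),
    (forall b, b \in L -> P b) /\
    forall t, t \in B' -> exists2 a, (a <= A)%N & a :: t \in L.
  elim: {B'min} B' B'P => [|t B' IHB'] B'P; first by exists [::], 0%N.
  have [|L [A [LP LA]]] := IHB'.
    by move=> u uB; apply: B'P; rewrite inE uB orbT.
  have [a Pa] := B'P t (mem_head _ _).
  exists ((a :: t) :: L), (maxn a A); split=> [b|u].
    by rewrite inE => /predU1P[->|/LP].
  rewrite inE => /predU1P[->|/LA[b bA bL]].
    by exists a; rewrite ?leq_maxl ?mem_head.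
  by exists b; rewrite ?inE ?bL ?orbT // leq_max bA orbT.
have [C [CP Cmin]] : exists C : seq (seq nat), (forall b, b \in C -> P b) /\
    forall a t, (a < A)%N -> P (a :: t) ->
    exists2 b, b \in C & forall i, (nth 0 b i <= nth 0 (a :: t) i)%N.
  elim: {LA} A => [|A [C [CP Cmin]]]; first by exists [::].
  have [|D [DP Dmin]] := IHn (fun t => P (A :: t)); first by move=> t /szP[].
  exists (map (cons A) D ++ C); split=> [b|a t].
    by rewrite mem_cat => /orP[/mapP[d /DP Pd ->]|/CP].
  rewrite ltnS leq_eqVlt => /predU1P[->|aA] Pat.
    have [d Dd dt] := Dmin t Pat.
    exists (A :: d); first by rewrite mem_cat map_f.
    by case=> //= i.
  have [b Cb bt] := Cmin a t aA Pat.
  by exists b => //; rewrite mem_cat Cb orbT.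
exists (L ++ C); split=> [b|s Ps].
  by rewrite mem_cat => /orP[/LP|/CP].
case: s Ps (szP s Ps) => // a t Pat _.
have [aA|Aa] := ltnP a A.
  by have [b Cb bt] := Cmin a t aA Pat; exists b => //; rewrite mem_cat Cb orbT.
have [|b Bb bt] := B'min t; first by exists a.
have [c cA Lc] := LA b Bb.
exists (c :: b); first by rewrite mem_cat Lc.
by case=> [|i] //=; apply: leq_trans cA Aa.
Qed.

Lemma dickson n (P : 'X_{1..n} -> Prop) :
  exists B : seq 'X_{1..n}, (forall b, b \in B -> P b) /\
    forall m, P m -> exists2 b, b \in B & (b <= m)%MM.
Proof.
have [|B [BP Bmin]] :=
  @dickson_seq n (fun s => exists2 m : 'X_{1..n}, s = m :> seq nat & P m).
  by move=> _ [m -> _]; rewrite size_tuple.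
have [C [CP BC]] : exists C : seq 'X_{1..n}, (forall c, c \in C -> P c) /\
    forall b, b \in B -> exists2 m, m \in C & b = m :> seq nat.
  elim: {Bmin} B BP => [|b B IHB] BP; first by exists [::].
  have [|C [CP BC]] := IHB.
    by move=> u uB; apply: BP; rewrite inE uB orbT.
  have [m bm Pm] := BP b (mem_head _ _).
  exists (m :: C); split=> [c|u]; first by rewrite inE => /predU1P[->|/CP].
  rewrite inE => /predU1P[->|/BC[c cC uc]]; first by exists m; rewrite ?mem_head.
  by exists c; rewrite // inE cC orbT.
exists C; split=> // m Pm.
have [|b /BC[c Cc ->] bm] := Bmin m; first by exists m.
exists c => //; apply/mnm_lepP => i.
by rewrite !(mnm_nth 0%N); apply: bm.
Qed.

(** Dickson's lemma selects finitely many elements of [I] whose leading monomials divide all the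
    others. Division by them strictly lowers the leading monomial, and the monomial order is well
    founded. *)
Lemma mpoly_noetherian (K : fieldType) n (I : {mpoly K[n]} -> Prop) :
  is_ideal I ->
  exists gs : seq {mpoly K[n]}, (forall g, g \in gs -> I g) /\
    forall f, I f -> spanned gs f.
Proof.
move=> [I0 ID IM].
pose lead m := exists g, [/\ I g, g != 0 & mlead g = m].
have [B [BP Bmin]] := dickson lead.
have [gs [gsI Bgs]] : exists gs : seq {mpoly K[n]}, (forall g, g \in gs -> I g) /\
    forall b, b \in B -> exists g, [/\ g \in gs, g != 0 & mlead g = b].
  elim: {Bmin} B BP => [|b B IHB] BP; first by exists [::].
  have [|gs [gsI Bgs]] := IHB.
    by move=> u uB; apply: BP; rewrite inE uB orbT.
  have [g [Ig g0 gb]] := BP b (mem_head _ _).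
  exists (g :: gs); split=> [h|u]; first by rewrite inE => /predU1P[->|/gsI].
  rewrite inE => /predU1P[->|/Bgs[h [hgs h0 hu]]].
    by exists g; rewrite mem_head.
  by exists h; rewrite inE hgs orbT.
exists gs; split=> // f.
have [S0 SD SM] := spanned_ideal gs.
move: {2}(mlead f) (erefl (mlead f)) => m.
elim/(ltmwf (n := n)): m f => m IH f fm If.
have [->//|f0] := eqVneq f 0.
have [|b Bb bm] := Bmin m; first by exists f.
have [g [gsg g0 gb]] := Bgs b Bb.
pose c := mleadc f / mleadc g; pose q := c *: 'X_[(m - b)%MM] * g.
have gc0 : mleadc g != 0 by rewrite mleadc_eq0.
have c0 : c != 0 by rewrite mulf_neq0 ?invr_eq0 ?mleadc_eq0.
have Xn0 : 'X_[(m - b)%MM] != 0 :> {mpoly K[n]}.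
  by rewrite -mleadc_eq0 mleadXm mcoeffX eqxx oner_eq0.
have cX0 : c *: 'X_[(m - b)%MM] != 0 :> {mpoly K[n]} by rewrite scaler_eq0 negb_or c0.
have qm : mlead q = m.
  by rewrite mleadM // mleadZ // mleadXm gb submK.
have qI : I q by apply: IM; apply: gsI.
have qS : spanned gs q by apply/SM/spanned_mem.
have -> : f = (f - q) + q by rewrite subrK.
apply: SD => //.
have Iq : I (f - q) by apply: ID => //; rewrite -mulN1r; apply: IM.
have [->//|fq0] := eqVneq (f - q) 0.
apply: (IH (mlead (f - q))) => //.
(* The leading terms of [f] and [q] cancel, so a nonzero [f - q] cannot have leading monomial
   [m]. *)
have fqm : (f - q)@_m = 0.
  have := mleadcM (c *: 'X_[(m - b)%MM]) g.
  rewrite -mleadM // qm mleadcZE mleadXm mcoeffX eqxx mulr1 /c divfK //.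
  by rewrite mcoeffB /q /c fm => ->; rewrite subrr.
rewrite lt_neqAle; apply/andP; split.
  by apply: contra_neq fq0 => e; apply/eqP; rewrite -mleadc_eq0 e fqm.
by have := mleadB_le f q; rewrite fm qm joinxx.
Qed.

(** Some power of the radical lies in [J] because the radical is finitely generated; the least such
    exponent then satisfies the specification given to [epsilon]. *)
Lemma nilpotP (K : fieldType) n (J : {mpoly K[n]} -> Prop) :
  is_ideal J -> is_nilpotency_index J (nilpot J).
Proof.
move=> Jid; apply: epsilon_spec.
have [gs [gsJ spanJ]] := mpoly_noetherian (radical_ideal Jid).
have [N prodJ] := spanned_nilpotent Jid gsJ.
pose nil k := forall f, ideal_exp (radical J) k f -> J f.
have nilN : nil N.
  move=> f Nf; apply: (ideal_exp_sub Nf) => // h szh hJ.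
  by apply: prodJ => [|x /hJ/spanJ//]; rewrite szh.
(* Excluded middle makes [nil] Boolean, as [ex_minn] requires. *)
have exP : exists k, excluded_middle_informative (nil k).
  by exists N; case: excluded_middle_informative.
exists (ex_minn exP); case: ex_minnP => k.
case: excluded_middle_informative => // nilk _ kmin; split=> // j nilj.
by apply: kmin; case: excluded_middle_informative.
Qed.

(** * A linear functional vanishing on the adjacent minors *)

(* The degree bound d only makes the range of summation finite. *)
Definition coefsum (K : fieldType) n d (p : pred 'X_{1..n}) (f : {mpoly K[n]}) :=
  \sum_(mu : 'X_{1..n < d} | p mu) f@_mu.

Lemma coefsumD (K : fieldType) n d (p : pred 'X_{1..n}) :
  {morph @coefsum K n d p : f g / f + g}.
Proof.
by move=> f g; rewrite /coefsum -big_split; apply: eq_bigr => mu _; rewrite mcoeffD.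
Qed.

Lemma coefsumZ (K : fieldType) n d (p : pred 'X_{1..n}) c (f : {mpoly K[n]}) :
  coefsum d p (c *: f) = c * coefsum d p f.
Proof.
by rewrite /coefsum mulr_sumr; apply: eq_bigr => mu _; rewrite mcoeffZ.
Qed.

Lemma coefsumB (K : fieldType) n d (p : pred 'X_{1..n}) :
  {morph @coefsum K n d p : f g / f - g}.
Proof.
by move=> f g; rewrite coefsumD -scaleN1r coefsumZ mulN1r.
Qed.

Lemma coefsum0 (K : fieldType) n d (p : pred 'X_{1..n}) :
  coefsum d p (0 : {mpoly K[n]}) = 0.
Proof. by rewrite /coefsum big1 // => mu _; rewrite mcoeff0. Qed.

Lemma coefsumX (K : fieldType) n d (p : pred 'X_{1..n}) nu :
  coefsum d p ('X_[nu] : {mpoly K[n]}) = ((mdeg nu < d)%N && p nu)%:R.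
Proof.
rewrite /coefsum big_mkcond /=.
have [nud|dnu] /= := ltnP (mdeg nu) d.
  rewrite (bigD1 (BMultinom nud)) //= big1 ?addr0 => [|mu munu].
    by rewrite mcoeffX eqxx; case: (p nu).
  rewrite mcoeffX; case: eqP => [numu|]; last by rewrite if_same.
  by case/eqP: munu; apply: val_inj.
rewrite big1 // => mu _; rewrite mcoeffX; case: eqP => [numu|]; last by rewrite if_same.
by have := valP mu; rewrite /= -numu ltnNge dnu.
Qed.

(** The functional is linear and every multiplier is a combination of monomials. *)
Lemma coefsum_mul_eq0 (K : fieldType) n d (p : pred 'X_{1..n}) (f : {mpoly K[n]}) :
    (forall nu, coefsum d p ('X_[nu] * f) = 0) ->
  forall a, coefsum d p (a * f) = 0.
Proof.
move=> f0 a; rewrite [a]mpolyE mulr_suml.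
rewrite (big_morph _ (coefsumD d p) (coefsum0 _ d p)) big1 // => nu _.
by rewrite -scalerAl coefsumZ f0 mulr0.
Qed.

(* Out of range, [var] is the monomial 1 and [expo] is 0. *)
Definition var m n (i j : nat) : 'X_{1..m * n} :=
  if (insub i, insub j) is (Some a, Some b) then U_(mxvec_index a b)%MM else 0%MM.

Definition expo m n (mu : 'X_{1..m * n}) (i j : nat) : nat :=
  if (insub i, insub j) is (Some a, Some b) then mu (mxvec_index a b) else 0%N.

Lemma varE m n (i : 'I_m) (j : 'I_n) : var m n i j = U_(mxvec_index i j)%MM.
Proof. by rewrite /var !valK. Qed.

Lemma expoD m n (mu nu : 'X_{1..m * n}) i j :
  expo (mu + nu)%MM i j = (expo mu i j + expo nu i j)%N.
Proof. by rewrite /expo; do 2!case: insub => [?|] //; rewrite mnmDE. Qed.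

Lemma expo0 m n i j : expo (0%MM : 'X_{1..m * n}) i j = 0%N.
Proof. by rewrite /expo; do 2!case: insub => [?|] //; rewrite mnm0E. Qed.

Lemma expo_var m n i j i' j' : (i < m)%N -> (j < n)%N ->
  expo (var m n i j) i' j' = ((i == i') && (j == j')) :> nat.
Proof.
move=> im jn; rewrite -[i]/(val (Ordinal im)) -[j]/(val (Ordinal jn)) varE /expo.
case: insubP => [a _ <-|].
  case: insubP => [b _ <-|].
    rewrite mnm1E !val_eqE; congr nat_of_bool; apply/eqP/andP => [e|].
      (* [mxvec_index] is a cast of the rank of the pair, hence injective. *)
      by have [-> ->] := enum_rank_inj (cast_ord_inj e).
    by case=> /eqP-> /eqP->.
  rewrite -leqNgt => nj'; rewrite [X in _ && X](_ : _ = false) ?andbF //.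
  by apply/eqP => /= e; move: nj'; rewrite -e leqNgt jn.
rewrite -leqNgt => mi'; rewrite [X in X && _](_ : _ = false) //.
by apply/eqP => /= e; move: mi'; rewrite -e leqNgt im.
Qed.

Lemma mdeg_var m n i j : (i < m)%N -> (j < n)%N -> mdeg (var m n i j) = 1%N.
Proof.
by move=> im jn; rewrite -[i]/(val (Ordinal im)) -[j]/(val (Ordinal jn)) varE mdeg1.
Qed.

Lemma minor2E (K : fieldType) m n (i i' : 'I_m) (j j' : 'I_n) :
  minor2 K i i' j j' =
    'X_[(var m n i j + var m n i' j')%MM] - 'X_[(var m n i j' + var m n i' j)%MM].
Proof. by rewrite /minor2 !mxE !mpolyXD !varE. Qed.

(* Block a consists of the rows (or columns) 4a, 4a + 1 and 4a + 2. *)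
Definition in_block A i := [exists a : 'I_A, (4 * a <= i)%N && (i < 4 * a + 3)%N].

Lemma in_blockP A i :
  reflect (exists a r, [/\ (a < A)%N, (r < 3)%N & i = (4 * a + r)%N]) (in_block A i).
Proof.
apply: (iffP existsP) => [[a /andP[ai ia]]|[a [r [aA r3 ->]]]].
  by exists a, (i - 4 * a)%N; split; [exact: ltn_ord| |]; lia.
by exists (Ordinal aA) => /=; lia.
Qed.

(* The exponents of a e i, b d i and a f h. *)
Record special3 (M : nat -> nat -> nat) : Prop := Special3 {
  _ : (M 0 0 + M 0 1 + M 0 2 = 1)%N; _ : (M 1 0 + M 1 1 + M 1 2 = 1)%N;
  _ : (M 2 0 + M 2 1 + M 2 2 = 1)%N; _ : (M 0 0 + M 1 0 + M 2 0 = 1)%N;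
  _ : (M 0 1 + M 1 1 + M 2 1 = 1)%N; _ : (M 0 2 + M 1 2 + M 2 2 = 1)%N;
  _ : M 0 2 = 0%N; _ : M 2 0 = 0%N }.

(** * Special exponents and their invariance under adjacent moves *)

Definition special A B (E : nat -> nat -> nat) : Prop :=
  (forall i j, (0 < E i j)%N -> in_block A i && in_block B j) /\
  (forall a b, (a < A)%N -> (b < B)%N ->
     special3 (fun r s => E (4 * a + r) (4 * b + s))%N).

(** Indices [4 * a + 3] lie in no block, so consecutive indices in blocks share a block. *)
Lemma in_block_succ A i : in_block A i -> in_block A i.+1 ->
  exists a r, [/\ (a < A)%N, i = (4 * a + r)%N & r = 0%N \/ r = 1%N].
Proof.
move=> /in_blockP[a [r [aA r3 ->]]] /in_blockP[b [s [bB s3 e]]].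
by exists a, r; split=> //; lia.
Qed.

Lemma special3_ext (M M' : nat -> nat -> nat) :
  (forall r s, (r < 3)%N -> (s < 3)%N -> M r s = M' r s) -> special3 M -> special3 M'.
Proof. by move=> MM' []; rewrite !MM' //; split. Qed.

(** A move preserves row and column sums. If its square contains a corner that must vanish, neither
    side is special: one side is positive at that corner, and on the other the sums force a 1 at the
    opposite corner. *)
Lemma special3_move (N E F : nat -> nat -> nat) r0 s0 :
    (r0 < 2)%N -> (s0 < 2)%N ->
    (forall r s, (r < 3)%N -> (s < 3)%N -> E r s = N r s +
       (((r0 == r) && (s0 == s)) + ((r0.+1 == r) && (s0.+1 == s))))%N ->
    (forall r s, (r < 3)%N -> (s < 3)%N -> F r s = N r s +
       (((r0 == r) && (s0.+1 == s)) + ((r0.+1 == r) && (s0 == s))))%N ->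
  special3 E <-> special3 F.
Proof.
move=> r2 s2 EE FE.
by split=> -[]; case: r0 r2 EE FE => [|[]] // _; case: s0 s2 => [|[]] // _ EE FE;
  rewrite ?EE // ?FE //= => *; split; rewrite ?EE ?FE //=; lia.
Qed.

Lemma eqn_block (a r a' r' : nat) : (r < 4)%N -> (r' < 4)%N ->
  ((4 * a + r)%N == (4 * a' + r')%N) = (a == a') && (r == r').
Proof. lia. Qed.

(** [E] and [F] are the exponents of the two terms of a monomial multiple of an adjacent minor. If
    either is special, the whole square of the move lies in one block, and [special3_move] applies
    there. *)
Lemma special_move A B (N E F : nat -> nat -> nat) i0 j0 :
    (forall i j, E i j = N i j + (((i0 == i) && (j0 == j)) +
                                  ((i0.+1 == i) && (j0.+1 == j))))%N ->
    (forall i j, F i j = N i j + (((i0 == i) && (j0.+1 == j)) +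
                                  ((i0.+1 == i) && (j0 == j))))%N ->
  special A B E <-> special A B F.
Proof.
move=> EE FE.
have step : in_block A i0 && in_block B j0 ->
    in_block A i0.+1 && in_block B j0.+1 -> special A B E <-> special A B F.
  move=> /andP[Ai Bj] /andP[Ai' Bj'].
  have cells i j : ((E i j > 0) || (F i j > 0) -> (N i j > 0) ||
      in_block A i && in_block B j)%N.
    rewrite EE FE; case: (N i j) => //=.
    by do 4!case: eqP => [<-|_]; rewrite ?Ai ?Ai' ?Bj ?Bj' ?andbF.
  have [a0 [r0 [aA i0E r0E]]] := in_block_succ Ai Ai'.
  have [b0 [s0 [bB j0E s0E]]] := in_block_succ Bj Bj'.
  have blk a b : special3 (fun r s => E (4 * a + r) (4 * b + s))%N <->
                 special3 (fun r s => F (4 * a + r) (4 * b + s))%N.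
    (* Either this block contains the move, or [E] and [F] agree on it. *)
    have [[<- <-]|nab] : (a0 = a /\ b0 = b) \/ (a0 == a) && (b0 == b) = false by lia.
      by apply: (@special3_move (fun r s => N (4 * a0 + r) (4 * b0 + s))%N _ _ r0 s0);
        (try by lia) => r s r3 s3; rewrite ?EE ?FE i0E j0E -!addnS !eqn_add2l.
    have EF r s : (r < 3)%N -> (s < 3)%N ->
        E (4 * a + r)%N (4 * b + s)%N = F (4 * a + r)%N (4 * b + s)%N.
      move=> r3 s3; rewrite EE FE i0E j0E -!addnS.
      have [rr ss] : (r < 4)%N /\ (s < 4)%N by lia.
      have [rr0 ss0] : (r0.+1 < 4)%N /\ (s0.+1 < 4)%N by lia.
      have [rr1 ss1] : (r0 < 4)%N /\ (s0 < 4)%N by lia.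
      by rewrite !eqn_block //; case: (a0 == a) nab => /= [->|_]; rewrite ?andbF.
    by split; apply: special3_ext => r s r3 s3; rewrite EF.
  split=> -[cell sp]; split=> [i j pos|a b aA' bB']; try by apply/blk/sp.
  - have := cells i j; rewrite pos orbT => /(_ isT)/orP[Npos|//].
    by apply: cell; rewrite EE; lia.
  - have := cells i j; rewrite pos => /(_ isT)/orP[Npos|//].
    by apply: cell; rewrite FE; lia.
(* The two cells that the move contributes to a special side are positive, hence in blocks; together
   they involve both rows and both columns. *)
split=> sp; apply step => //; have [cell _] := sp.
- by apply: cell; rewrite EE !eqxx; lia.
- by apply: cell; rewrite EE !eqxx; lia.
- have /andP[-> _] := cell i0 j0.+1 ltac:(rewrite FE !eqxx; lia).
  by have /andP[_ ->] := cell i0.+1 j0 ltac:(rewrite FE !eqxx; lia).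
- have /andP[_ ->] := cell i0 j0.+1 ltac:(rewrite FE !eqxx; lia).
  by have /andP[-> _] := cell i0.+1 j0 ltac:(rewrite FE !eqxx; lia).
Qed.

Definition specialb A B m n (mu : 'X_{1..m * n}) : bool :=
  excluded_middle_informative (special A B (expo mu)).

Lemma specialbP A B m n (mu : 'X_{1..m * n}) :
  reflect (special A B (expo mu)) (specialb A B mu).
Proof.
by rewrite /specialb; case: excluded_middle_informative => ?; constructor.
Qed.

(** The two terms of a monomial multiple of a minor have equal degree and are special together, so
    they cancel for any bound [d]. *)
Lemma coefsum_adjacent (K : fieldType) m n A B d (f : {mpoly K[m * n]}) :
  adjacent_minors_ideal f -> coefsum d (@specialb A B m n) f = 0.
Proof.
(* The factor 1 is generalized: the polynomials all of whose multiples are killed form an ideal, as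
   [ideal_gen_sub] demands. *)
move=> Jf; rewrite -[f]mul1r; move: {1}1; move: f Jf; apply: ideal_gen_sub.
  split=> [a|f g f0 g0 a|b f f0 a]; first by rewrite mulr0 coefsum0.
    by rewrite mulrDr coefsumD f0 g0 addr0.
  by rewrite mulrA.
move=> _ [i [i' [j [j' [ii' jj' ->]]]]]; apply: coefsum_mul_eq0 => nu.
rewrite minor2E mulrBr -!mpolyXD coefsumB !coefsumX.
rewrite !mdegD !mdeg_var //.
rewrite (_ : specialb A B _ =
             specialb A B (nu + (var m n i j' + var m n i' j))) ?subrr //.
have im : (i.+1 < m)%N by rewrite -ii'.
have jn : (j.+1 < n)%N by rewrite -jj'.
have move_iff : special A B (expo (nu + (var m n i j + var m n i' j'))) <->
    special A B (expo (nu + (var m n i j' + var m n i' j))).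
  by apply: (@special_move _ _ (expo nu) _ _ i j) => r s;
    rewrite !expoD !expo_var ?ii' ?jj'.
by apply/specialbP/specialbP => ?; apply/move_iff.
Qed.

(** * Block binomials: squares in the ideal, full product outside it *)

Definition diag_mnm m n a b : 'X_{1..m * n} :=
  (var m n (4 * a) (4 * b) + var m n (4 * a + 1) (4 * b + 1) +
   var m n (4 * a + 2) (4 * b + 2))%MM.

Definition antidiag_mnm m n a b : 'X_{1..m * n} :=
  (var m n (4 * a) (4 * b + 2) + var m n (4 * a + 1) (4 * b + 1) +
   var m n (4 * a + 2) (4 * b))%MM.

Definition block_binomial (K : fieldType) m n a b : {mpoly K[m * n]} :=
  'X_[diag_mnm m n a b] - 'X_[antidiag_mnm m n a b].

Lemma adjacent_minor_mem (K : fieldType) m n i j :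
    (i.+1 < m)%N -> (j.+1 < n)%N ->
  adjacent_minors_ideal ('X_[var m n i j] * 'X_[var m n i.+1 j.+1] -
    'X_[var m n i j.+1] * 'X_[var m n i.+1 j] : {mpoly K[m * n]}).
Proof.
move=> im jn; apply: ideal_gen_mem.
exists (Ordinal (ltnW im)), (Ordinal im), (Ordinal (ltnW jn)), (Ordinal jn).
by split=> //; rewrite minor2E !mpolyXD.
Qed.

Lemma block_square_mem (R : comNzRingType) (J : R -> Prop) (x : nat -> nat -> R) :
    is_ideal J ->
    (forall r s, (r < 2)%N -> (s < 2)%N ->
       J (x r s * x r.+1 s.+1 - x r s.+1 * x r.+1 s)) ->
  J ((x 0%N 0%N * x 1%N 1%N * x 2%N 2%N - x 0%N 2%N * x 1%N 1%N * x 2%N 0%N) ^+ 2).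
Proof.
move=> [_ JD JM] minors.
have := minors 1%N 1%N isT isT; have := minors 1%N 0%N isT isT.
have := minors 0%N 1%N isT isT; have := minors 0%N 0%N isT isT.
set d00 := _ - _; set d01 := _ - _; set d10 := _ - _; set d11 := _ - _.
move=> J00 J01 J10 J11.
(* Modulo the minors, x11^2 x00 x22 and x11^2 x02 x20 both equal
   x01 x10 x12 x21. *)
have -> : (x 0%N 0%N * x 1%N 1%N * x 2%N 2%N - x 0%N 2%N * x 1%N 1%N * x 2%N 0%N) ^+ 2 =
    (x 0%N 0%N * x 2%N 2%N - x 0%N 2%N * x 2%N 0%N) * (x 1%N 1%N * x 2%N 2%N) * d00 +
    (x 0%N 0%N * x 2%N 2%N - x 0%N 2%N * x 2%N 0%N) * (x 0%N 1%N * x 1%N 0%N) * d11 +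
    ((x 0%N 0%N * x 2%N 2%N - x 0%N 2%N * x 2%N 0%N) * (x 1%N 1%N * x 2%N 0%N) * d01 +
     (x 0%N 0%N * x 2%N 2%N - x 0%N 2%N * x 2%N 0%N) * (x 0%N 1%N * x 1%N 2%N) * d10).
  by rewrite /d00 /d01 /d10 /d11; ring.
by apply: (JD); apply: (JD); apply: (JM).
Qed.

Lemma block_binomial_radical (K : fieldType) m n a b :
    (4 * a + 2 < m)%N -> (4 * b + 2 < n)%N ->
  radical (@adjacent_minors_ideal K m n) (block_binomial K m n a b).
Proof.
move=> am bn; exists 2%N => //; rewrite /block_binomial !mpolyXD.
have := @block_square_mem _ (@adjacent_minors_ideal K m n)
  (fun r s => 'X_[var m n (4 * a + r) (4 * b + s)]) (ideal_gen_ideal _).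
rewrite !addn0; apply=> r s r2 s2.
by rewrite !addnS; apply: adjacent_minor_mem; lia.
Qed.

(** The factor is positive at the upper right corner of the block, so no multiple of it is
    special. *)
Lemma coefsum_antidiag (K : fieldType) m n A B d a b (f : {mpoly K[m * n]}) :
    (a < A)%N -> (b < B)%N -> (4 * a + 2 < m)%N -> (4 * b + 2 < n)%N ->
  coefsum d (@specialb A B m n) (f * 'X_[antidiag_mnm m n a b]) = 0.
Proof.
move=> aA bB am bn; apply: coefsum_mul_eq0 => nu.
rewrite -mpolyXD coefsumX; case: specialbP; rewrite ?andbF // => -[_ sp].
have [_ _ _ _ _ _ + _] := sp a b aA bB.
by rewrite /antidiag_mnm !expoD !expo_var ?addn0 ?eqxx //; lia.
Qed.

(** Expanding one binomial at a time, each antidiagonal term is killed and [f] absorbs the diagonal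
    one. The bound on [A] says that the last block, ending at row [4 * A - 2], fits; the gap after
    it may fall outside. *)
Lemma coefsum_block_prod (K : fieldType) m n A B d (L : seq ('I_A * 'I_B))
    (f : {mpoly K[m * n]}) :
    (4 * A <= m.+1)%N -> (4 * B <= n.+1)%N ->
  coefsum d (@specialb A B m n)
    (f * \prod_(c <- L) block_binomial K m n c.1 c.2) =
  coefsum d (@specialb A B m n)
    (f * 'X_[\big[+%MM/0%MM]_(c <- L) diag_mnm m n c.1 c.2]).
Proof.
move=> Am Bn; elim: L f => [|c L IHL] f; first by rewrite !big_nil mpolyX0.
have cm : (4 * c.1 + 2 < m)%N by have := ltn_ord c.1; lia.
have cn : (4 * c.2 + 2 < n)%N by have := ltn_ord c.2; lia.
rewrite !big_cons; set P := \prod_(_ <- _) _.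
have -> : f * (block_binomial K m n c.1 c.2 * P) =
    f * 'X_[diag_mnm m n c.1 c.2] * P - f * P * 'X_[antidiag_mnm m n c.1 c.2].
  by rewrite /block_binomial; ring.
rewrite coefsumB (coefsum_antidiag _ _ (ltn_ord c.1) (ltn_ord c.2) cm cn) subr0.
by rewrite IHL mpolyXD mulrA.
Qed.

Lemma special_diag m n A B :
    (4 * A <= m.+1)%N -> (4 * B <= n.+1)%N ->
  special A B (expo (\big[+%MM/0%MM]_(c : 'I_A * 'I_B) diag_mnm m n c.1 c.2)).
Proof.
move=> Am Bn.
have expo_sum i j :
    expo (\big[+%MM/0%MM]_(c : 'I_A * 'I_B) diag_mnm m n c.1 c.2) i j =
    (\sum_(c : 'I_A * 'I_B) expo (diag_mnm m n c.1 c.2) i j)%N.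
  apply: (big_morph (fun mu : 'X_{1..m * n} => expo mu i j)) => [mu nu|].
    exact: expoD.
  exact: expo0.
have expo_diag (c : 'I_A * 'I_B) i j : expo (diag_mnm m n c.1 c.2) i j =
    (((4 * c.1 == i) && (4 * c.2 == j)) + ((4 * c.1 + 1 == i) && (4 * c.2 + 1 == j))
     + ((4 * c.1 + 2 == i) && (4 * c.2 + 2 == j)))%N.
  have cm : (4 * c.1 + 2 < m)%N by have := ltn_ord c.1; lia.
  have cn : (4 * c.2 + 2 < n)%N by have := ltn_ord c.2; lia.
  by rewrite /diag_mnm !expoD !expo_var //; lia.
split=> [i j|a b aA bB].
  rewrite expo_sum lt0n sum_nat_eq0 negb_forall => /existsP[c] /=.
  have [cA cB] := (ltn_ord c.1, ltn_ord c.2).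
  rewrite expo_diag => nz.
  have [t [t3 -> ->]] : exists t, [/\ (t < 3)%N, i = (4 * c.1 + t)%N & j = (4 * c.2 + t)%N].
    move: nz; case: andP => [[/eqP <- /eqP <-] _|_]; first by exists 0%N; rewrite !addn0.
    case: andP => [[/eqP <- /eqP <-] _|_]; first by exists 1%N.
    by case: andP => [[/eqP <- /eqP <-] _|//]; exists 2%N.
  by apply/andP; split; apply/in_blockP; [exists c.1, t | exists c.2, t].
(* Each block restricts to the identity matrix, the exponents of [a e i]. *)
apply: (@special3_ext (fun r s => nat_of_bool (r == s))); last by [].
move=> r s r3 s3; rewrite expo_sum.
have block (c : 'I_A * 'I_B) :
    expo (diag_mnm m n c.1 c.2) (4 * a + r) (4 * b + s) =
    ((c == (Ordinal aA, Ordinal bB)) && (r == s)) :> nat.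
  rewrite expo_diag -{1}[(4 * c.1)%N]addn0 -{1}[(4 * c.2)%N]addn0.
  have [r4 s4] : (r < 4)%N /\ (s < 4)%N by lia.
  rewrite !eqn_block // -pair_eqE /pair_eq /= -!val_eqE /=.
  case: (_ == a) => //=; case: (_ == b); rewrite ?andbF //=.
  by case: r r3 {r4} => [|[|[|]]] //; case: s s3 {s4} => [|[|[|]]].
rewrite (eq_bigr _ (fun c _ => block c)) (bigD1 (Ordinal aA, Ordinal bB)) //=.
rewrite eqxx big1 ?addn0 // => c /negPf-> //.
Qed.

Lemma block_prod_notin (K : fieldType) m n A B :
    (4 * A <= m.+1)%N -> (4 * B <= n.+1)%N ->
  ~ adjacent_minors_ideal
      (\prod_(c : 'I_A * 'I_B) block_binomial K m n c.1 c.2).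
Proof.
move=> Am Bn; set mu := (\big[+%MM/0%MM]_(c : 'I_A * 'I_B) diag_mnm m n c.1 c.2)%MM.
(* The least degree bound that still counts [mu]. *)
move/(coefsum_adjacent A B (mdeg mu).+1)/eqP.
rewrite -[X in coefsum _ _ X]mul1r coefsum_block_prod // mul1r coefsumX ltnSn.
by case: specialbP => [_|[]]; [rewrite oner_eq0 | apply: special_diag].
Qed.

(** * The lower bound and pairs of paths *)

Lemma ideal_exp_prod (R : comNzRingType) (I : R -> Prop) (T : eqType) (F : T -> R) s :
  (forall c, c \in s -> I (F c)) -> ideal_exp I (size s) (\prod_(c <- s) F c).
Proof.
elim: s => //= c s IHs IF; apply: ideal_gen_mem.
exists (F c), (\prod_(c <- s) F c); split; last by rewrite big_cons.
  by apply: IF; rewrite mem_head.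
by apply: IHs => d ds; apply: IF; rewrite inE ds orbT.
Qed.

(** If the index [k] were at most [A * B], the product of the first [k] block binomials would lie in
    the ideal, and so would the full product. *)
Lemma nilpot_adjacent_gt (K : fieldType) m n A B :
    (4 * A <= m.+1)%N -> (4 * B <= n.+1)%N ->
  (A * B < nilpot (@adjacent_minors_ideal K m n))%N.
Proof.
move=> Am Bn; have Jid : is_ideal (@adjacent_minors_ideal K m n) := ideal_gen_ideal _.
have [nil _] := nilpotP Jid; set k := nilpot _ in nil *.
rewrite ltnNge; apply/negP => kAB; apply: (@block_prod_notin K m n A B) => //.
pose L := index_enum ('I_A * 'I_B)%type.
have szL : size (take k L) = k.
  by apply: size_takel; rewrite /L [index_enum _]unlock -enumT -cardT card_prod !card_ord.
rewrite -/L -(cat_take_drop k L) big_cat /= mulrC; have [_ _] := Jid; apply.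
apply: nil; rewrite -[k in ideal_exp _ k]szL; apply: ideal_exp_prod => -[a b] _.
have [aA bB] := (ltn_ord a, ltn_ord b).
by apply: block_binomial_radical => /=; lia.
Qed.

Definition path_graph n : rel 'I_n :=
  fun i j => (j == i.+1 :> nat) || (i == j.+1 :> nat).

Lemma path_graph_simple n : simple_graph (@path_graph n).
Proof.
by split=> [i j|i]; rewrite /path_graph; [rewrite orbC | lia].
Qed.

(** In a path, an edge with [i < j] has [j = i + 1], so both generating sets coincide. Equality of
    predicates allows rewriting under [nilpot]. *)
Lemma binomial_edge_ideal_path (K : fieldType) m n :
  @binomial_edge_ideal K m n (@path_graph m) (@path_graph n) =
  @adjacent_minors_ideal K m n.
Proof.
congr ideal_gen.
apply: functional_extensionality => f; apply: propositional_extensionality.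
split=> [[i [i' [j [j' [ii' jj' /orP[] /eqP e /orP[] /eqP e' ->]]]]]|]; try lia.
  by exists i, i', j, j'.
move=> [i [i' [j [j' [ii' jj' ->]]]]]; exists i, i', j, j'.
by split=> //; rewrite /path_graph ?ii' ?jj' ?eqxx.
Qed.

Local Close Scope ring_scope.

Theorem corollary5p3 (K : fieldType) :
  (forall m n k l p q : nat,
     m = 4 * k + p -> p < 4 -> n = 4 * l + q -> q < 4 ->
     (k + p %/ 3) * (l + q %/ 3) + 1 <= nilpot (@adjacent_minors_ideal K m n))
  /\
  (forall N : nat,
     exists (m n : nat) (E1 : rel 'I_m) (E2 : rel 'I_n),
       [/\ simple_graph E1, simple_graph E2 &
           N <= nilpot (@binomial_edge_ideal K m n E1 E2)]).
Proof.
split=> [m n k l p q mE p4 nE q4|N].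
  (* Here [A = k + p %/ 3]: three leftover rows hold one more block, and then [4 * A = m.+1]. *)
  by rewrite addn1; apply: nilpot_adjacent_gt; lia.
(* This size holds [N] blocks stacked in a single column. *)
exists (4 * N), 4, (@path_graph _), (@path_graph _).
split; try exact: path_graph_simple.
rewrite binomial_edge_ideal_path; apply: ltnW; rewrite -{1}[N]muln1.
by apply: nilpot_adjacent_gt; lia.
Qed.
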